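(* Let $T>0$, $U_T=U\times(0,T]$, $\overline{U_T}=\bar U\times[0,T]$ and $\partial_pU_T=\overline{U_T}\setminus U_T$. Assume $u\in C(\overline{U_T})\cap C^{2,1}_{x,t}(U_T)$, $u\ge0$ on $\overline{U_T}$, and $u$ satisfies $u_t=\nabla\cdot\big(X(u,\nabla u+u^2\mathcal Z(x,t))\big)$ in $U_T$. Then $\max_{\overline{U_T}}u=\max_{\partial_pU_T}u$.
   Context: Let $N\ge1$ be an integer, $0=\bar\alpha_0<\bar\alpha_1<\dots<\bar\alpha_N$, $a_0,\dots,a_N>0$, $g(s)=\sum_{i=0}^Na_is^{\bar\alpha_i}$ for $s\ge0$ ($0^0=1$). Fix a unit vector $\vec k\in\mathbb R^3$ and let $\mathbf J$ be the matrix with $\mathbf Jx=\vec k\times x$. For $z\in\mathbb R$, $F_z(v)=g(|v|)v+z\mathbf Jv$ is a bijection of $\mathbb R^3$; fix $R_*\ge0$ and let $X(z,y)=F_{R_*z}^{-1}(y)$ for $z\in\mathbb R$, $y\in\mathbb R^3$. Let $\mathcal G>0$, $\Omega\ge0$, $e_0\in C^\infty(\mathbb R,\mathbb R^3)$ with $|e_0(t)|=1$, and $\mathcal Z(x,t)=-\mathcal Ge_0(t)+\Omega^2\mathbf J^2x$. $U\subset\mathbb R^3$ is open, bounded, with $C^1$ boundary. *)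

(* Defs.v *)
From HB Require Import structures.
From mathcomp Require Import all_boot all_order all_algebra.
From mathcomp Require Import all_classical all_reals all_analysis.
Set Implicit Arguments. Unset Strict Implicit. Unset Printing Implicit Defensive.
Import Order.TTheory GRing.Theory Num.Theory.
Import numFieldNormedType.Exports.
Local Open Scope classical_set_scope.
Local Open Scope ring_scope.

Section Defs.
Variable R : realType.

Definition ev (n : nat) (i : 'I_n) : 'rV[R]_n := delta_mx 0 i.

(* Euclidean norm (the library norm on matrices is the sup norm) *)
Definition enorm (n : nat) (v : 'rV[R]_n) : R := Num.sqrt (\sum_i v 0 i ^+ 2).

Definition cross (a b : 'rV[R]_3) : 'rV[R]_3 :=
  \row_(i < 3) (a 0 (ordS i) * b 0 (ordS (ordS i)) - a 0 (ordS (ordS i)) * b 0 (ordS i)).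

Definition Jmap (k x : 'rV[R]_3) : 'rV[R]_3 := cross k x.

(* g(s) = sum_{i=0}^N a_i s^{alpha_i}, with 0^0 = 1 (powR convention) *)
Definition gfun (N : nat) (a alpha : nat -> R) (s : R) : R :=
  \sum_(i < N.+1) a i * powR s (alpha i).

Definition Ffun (N : nat) (a alpha : nat -> R) (k : 'rV[R]_3) (z : R) (v : 'rV[R]_3)
  : 'rV[R]_3 := gfun N a alpha (enorm v) *: v + z *: Jmap k v.

(* X(z,y) = F_{R_* z}^{-1}(y)   (F_{R_* z} is a bijection of R^3) *)
Definition Xfun (N : nat) (a alpha : nat -> R) (k : 'rV[R]_3) (Rs : R) (z : R)
  (y : 'rV[R]_3) : 'rV[R]_3 :=
  xget 0 [set v | Ffun N a alpha k (Rs * z) v = y].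

Definition Zfun (G Om : R) (e0 : R -> 'rV[R]_3) (k x : 'rV[R]_3) (t : R) : 'rV[R]_3 :=
  - (G *: e0 t) + (Om ^+ 2) *: Jmap k (Jmap k x).

Definition smooth_curve (e : R -> 'rV[R]_3) : Prop :=
  forall (i : 'I_3) (n : nat) (t : R), derivable (derive1n n (fun s => e s 0 i)) t 1.

Definition C1_fun2 (gam : 'rV[R]_2 -> R) : Prop :=
  forall i : 'I_2, (forall y, derivable gam y (ev i)) /\
                   continuous (fun y => derive gam y (ev i)).

(* C^1 boundary (Evans): near each boundary point, after an orthogonal change of
   coordinates, U is the region above the graph of a C^1 function *)
Definition C1_boundary (U : set 'rV[R]_3) : Prop :=
  forall x0, closure U x0 -> ~ U x0 ->
    exists r : R, 0 < r /\
    exists Q : 'M[R]_3, Q *m Q^T = 1%:M /\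
    exists gam : 'rV[R]_2 -> R, C1_fun2 gam /\
      forall x : 'rV[R]_3, enorm (x - x0) < r ->
        (U x <-> gam (\row_(j < 2) (x *m Q) 0 (lift ord_max j)) < (x *m Q) 0 ord_max).

Definition grad (f : 'rV[R]_3 -> R) (x : 'rV[R]_3) : 'rV[R]_3 :=
  \row_(i < 3) derive f x (ev i).

Definition has_deriv_within (f : R -> R) (A : set R) (t l : R) : Prop :=
  (fun h => h^-1 * (f (t + h) - f t)) @ within (fun h => A (t + h)) (0 : R)^' --> l.

End Defs.

Arguments ev {R n} i.
Arguments grad {R} f x.

(* Main.v *)
Require Import Defs.
From HB Require Import structures.
From mathcomp Require Import all_boot all_order all_algebra.
From mathcomp Require Import all_classical all_reals all_analysis.
From mathcomp Require Import ring lra.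
Set Implicit Arguments. Unset Strict Implicit. Unset Printing Implicit Defensive.
Import Order.TTheory GRing.Theory Num.Theory.
Import numFieldNormedType.Exports.
Local Open Scope classical_set_scope.
Local Open Scope ring_scope.

(* Perturb [u] to [w := u - d t] with [d > 0]. If the maximum of [w] over the compact set
   [cl U_T] were attained at an interior (or final-time) point, then there [u_t >= d] while
   [grad u = 0] and the Hessian [H] is symmetric negative semidefinite, so the divergence
   reduces to [tr (A (H + u^2 Om^2 J^2))] where [A] is the inverse of the Jacobian of [F_z].
   Since [g] is increasing, [A] is positive definite, and [J^2] is symmetric negative
   semidefinite, so this trace is nonpositive: contradiction. Hence [w] is maximal on the
   parabolic boundary, and [d -> 0] concludes.

   [X(z, y)] need not be differentiated in general: strong monotonicity of [F_z], uniform
   in [z], gives its directional derivative at the one point needed. *)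

(** * Euclidean inner product and norm *)

Section Dot.
Context {R : realType} {n : nat}.
Implicit Types (c : R) (x y v : 'rV[R]_n).

Definition dot x y : R := \sum_i x 0 i * y 0 i.

Lemma dotC x y : dot x y = dot y x.
Proof. by apply: eq_bigr => i _; rewrite mulrC. Qed.

Lemma dotDl x y v : dot (x + y) v = dot x v + dot y v.
Proof. by rewrite -big_split; apply: eq_bigr => i _; rewrite /= !mxE mulrDl. Qed.

Lemma dotZl c x y : dot (c *: x) y = c * dot x y.
Proof. by rewrite mulr_sumr; apply: eq_bigr => i _; rewrite !mxE mulrA. Qed.

Lemma dotDr x y v : dot v (x + y) = dot v x + dot v y.
Proof. by rewrite dotC dotDl !(dotC v). Qed.

Lemma dotZr c x y : dot x (c *: y) = c * dot x y.
Proof. by rewrite dotC dotZl dotC. Qed.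

Lemma dot0l x : dot 0 x = 0.
Proof. by rewrite -(scale0r x) dotZl mul0r. Qed.

Lemma dotNl x y : dot (- x) y = - dot x y.
Proof. by rewrite -scaleN1r dotZl mulN1r. Qed.

Lemma dotNr x y : dot x (- y) = - dot x y.
Proof. by rewrite dotC dotNl dotC. Qed.

Lemma dotxx_ge0 x : 0 <= dot x x.
Proof. by apply: sumr_ge0 => i _; rewrite -expr2 sqr_ge0. Qed.

Lemma dotxx_eq0 x : (dot x x == 0) = (x == 0).
Proof.
apply/idP/eqP => [|->]; last by apply/eqP/big1 => i _; rewrite mxE mul0r.
rewrite psumr_eq0 => [/allP x0|i _]; last by rewrite -expr2 sqr_ge0.
apply/rowP => i; have := x0 i (mem_index_enum i).
by rewrite mxE -expr2 sqrf_eq0 => /eqP.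
Qed.

Lemma enormE x : enorm x = Num.sqrt (dot x x).
Proof. by congr Num.sqrt; apply: eq_bigr => i _; rewrite expr2. Qed.

Lemma enorm_ge0 x : 0 <= enorm x.
Proof. exact: sqrtr_ge0. Qed.

Lemma sqr_enorm x : enorm x ^+ 2 = dot x x.
Proof. by rewrite enormE sqr_sqrtr // dotxx_ge0. Qed.

Lemma enorm_eq0 x : (enorm x == 0) = (x == 0).
Proof. by rewrite -dotxx_eq0 -sqr_enorm sqrf_eq0. Qed.

(** Cauchy-Schwarz: the square of [enorm y *: x - enorm x *: y] equals
    [2 |x| |y| (|x| |y| - x.y)]. *)
Lemma dot_le_enorm x y : dot x y <= enorm x * enorm y.
Proof.
have [->|x0] := eqVneq x 0.
  by rewrite dot0l mulr_ge0 ?enorm_ge0.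
have [->|y0] := eqVneq y 0.
  by rewrite dotC dot0l mulr_ge0 ?enorm_ge0.
have p0 : 0 < enorm x by rewrite lt_neqAle enorm_ge0 eq_sym enorm_eq0 x0.
have q0 : 0 < enorm y by rewrite lt_neqAle enorm_ge0 eq_sym enorm_eq0 y0.
have := dotxx_ge0 (enorm y *: x - enorm x *: y).
rewrite dotDl !dotDr !dotNl !dotNr !dotZl !dotZr (dotC y x) -!sqr_enorm => h.
rewrite -(ler_pM2l (mulr_gt0 p0 q0)); nra.
Qed.

Lemma enormZ c x : enorm (c *: x) = `|c| * enorm x.
Proof.
by rewrite !enormE dotZl dotZr mulrA -expr2 sqrtrM ?sqr_ge0 // sqrtr_sqr.
Qed.

Lemma coord_le_enorm x i : `|x 0 i| <= enorm x.
Proof.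
rewrite -sqrtr_sqr ler_sqrt ?sumr_ge0 //; last by move=> j _; rewrite sqr_ge0.
by rewrite (bigD1 i) //= lerDl sumr_ge0 // => j _; rewrite sqr_ge0.
Qed.

End Dot.

(** * Semidefinite forms and the trace of a product *)

Section QuadraticForms.
Context {R : realType} {n : nat}.
Implicit Types (A M : 'M[R]_n) (x : 'rV[R]_n).

(** Symmetry is not built in, because the inverse Jacobian of [F_z] is not symmetric in general. *)
Definition psd M := forall x, 0 <= dot (x *m M) x.

Lemma dot_mulmx_tr M x y : dot (x *m M) y = dot x (y *m M^T).
Proof.
have dotE (u v : 'rV[R]_n) : dot u v = (u *m v^T) 0 0.
  by rewrite mxE; apply: eq_bigr => i _; rewrite mxE.
by rewrite !dotE trmx_mul trmxK mulmxA.
Qed.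

Lemma dot_delta x i : dot x (delta_mx 0 i) = x 0 i.
Proof.
rewrite /dot (bigD1 i) //= mxE !eqxx mulr1 big1 ?addr0 // => j ji.
by rewrite mxE (negbTE ji) andbF mulr0.
Qed.

Lemma psd_diag_ge0 M i : psd M -> 0 <= M i i.
Proof. by move=> /(_ (delta_mx 0 i)); rewrite -rowE dot_delta mxE. Qed.

Lemma psd_cauchy M x y : M^T = M -> psd M ->
  dot (x *m M) y ^+ 2 <= dot (x *m M) x * dot (y *m M) y.
Proof.
move=> sM pM.
have sym : dot (y *m M) x = dot (x *m M) y by rewrite dot_mulmx_tr sM dotC.
have q t s : 0 <= t ^+ 2 * dot (x *m M) x + s ^+ 2 * dot (y *m M) y
                + 2 * t * s * dot (x *m M) y.
  have := pM (t *: x + s *: y).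
  rewrite mulmxDl -!scalemxAl !dotDl !dotDr !dotZl !dotZr sym => /le_trans; apply.
  by rewrite le_eqVlt; apply/orP; left; apply/eqP; ring.
have px := pM x; have py := pM y.
move: sym q px py => _; move: (dot (x *m M) x) (dot (y *m M) y) (dot (x *m M) y).
move=> a c b q a0 c0.
have [c0'|cn] := eqVneq c 0.
  have [->|b0] := eqVneq b 0; first by rewrite expr0n /= mulr_ge0.
  (* With [c = 0] the form is affine in [s], and this [s] gives it the value [-1]. *)
  have := q 1 (- ((a + 1) / (2 * b))); rewrite c0' mulr0 addr0.
  have -> : 2 * 1 * - ((a + 1) / (2 * b)) * b = - (a + 1) by field.
  by rewrite expr1n; lra.
have cp : 0 < c by rewrite lt_neqAle c0 eq_sym cn.
(* The value of the form here is [c (a c - b^2)]. *)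
have h := q c (- b); rewrite -(ler_pM2l cp); nra.
Qed.

(* Symmetric elimination of one diagonal entry keeps [M] positive and lowers the
   number of nonzero diagonal entries. *)
Lemma mxtrace_mul_ge0 M A : M^T = M -> psd M -> psd A -> 0 <= \tr (M *m A).
Proof.
move=> sM pM pA.
elim: {M}_.+1 {-2}M (ltnSn #|[pred i | M i i != 0]|) sM pM => // m IH M.
move=> le_m sM pM.
have symM i j : M i j = M j i by rewrite -{1}sM mxE.
have [/existsP [i Mi0]|] := boolP [exists i, M i i != 0]; last first.
  rewrite negb_exists => /forallP Mi0.
  suff -> : M = 0 by rewrite mul0mx mxtrace0.
  apply/matrixP => i j; rewrite !mxE; apply/eqP; rewrite -sqrf_eq0 -[_ == 0]orbF.
  have := psd_cauchy (delta_mx 0 i) (delta_mx 0 j) sM pM.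
  rewrite -!rowE !dot_delta !mxE; have /negbNE/eqP -> := Mi0 i.
  by rewrite mul0r orbF eq_le sqr_ge0 andbT.
have Mi_gt0 : 0 < M i i by rewrite lt_neqAle eq_sym Mi0 psd_diag_ge0.
pose r := row i M.
pose M' := M - (M i i)^-1 *: (r^T *m r).
have dr x : x *m r^T *m r = dot x r *: r.
  by rewrite [x *m _]mx11_scalar mul_scalar_mx; congr (_ *: _); rewrite mxE;
     apply: eq_bigr => j _; rewrite !mxE.
have M'E j l : M' j l = M j l - (M i i)^-1 * (M i j * M i l).
  by rewrite !mxE big_ord1 !mxE.
have -> : M = M' + (M i i)^-1 *: (r^T *m r) by rewrite subrK.
(* The removed rank-one term contributes [r A r^T / M i i] to the trace. *)
rewrite mulmxDl raddfD /=; apply: addr_ge0; last first.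
  rewrite -scalemxAl mxtraceZ; apply: mulr_ge0; first by rewrite invr_ge0 ltW.
  rewrite -mulmxA mxtrace_mulC /mxtrace big_ord1 mxE.
  suff <- : dot (r *m A) r = \sum_j (r *m A) 0 j * r^T j 0 by exact: pA.
  by apply: eq_bigr => j _; rewrite [r^T _ _]mxE.
apply: IH; last 2 first.
- by apply/matrixP => j l; rewrite mxE !M'E symM (mulrC (M i l)).
(* Cauchy-Schwarz between the [i]-th basis vector and [x] bounds [(r.x)^2] by [M i i] times the form
   at [x]. *)
- move=> x; rewrite mulmxBr -scalemxAr mulmxA dr dotDl dotNl !dotZl (dotC r x).
  have := psd_cauchy (delta_mx 0 i) x sM pM.
  rewrite -rowE dot_delta [X in _ <= X * _]mxE -/r (dotC r x) => h.
  by rewrite subr_ge0 mulrC ler_pdivrMr // [leRHS]mulrC -expr2.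
(* If [M j j = 0] then [M i j = 0], so [M' j j = 0]; the entry at [i] is newly zero, and the count
   drops. *)
rewrite ltnS in le_m; apply: leq_trans le_m; apply: proper_card; apply/properP; split.
  apply/fintype.subsetP => j; rewrite !inE; apply: contra => /eqP Mj0.
  have Mij0 : M i j = 0.
    apply/eqP; rewrite -sqrf_eq0 eq_le sqr_ge0 andbT.
    have := psd_cauchy (delta_mx 0 i) (delta_mx 0 j) sM pM.
    by rewrite -!rowE !dot_delta !mxE Mj0 mulr0.
  by rewrite M'E Mj0 Mij0 !(mulr0, mul0r, subr0).
by exists i; rewrite !inE // M'E negbK; apply/eqP; field.
Qed.

End QuadraticForms.

Lemma cvg_sum {R : realType} {T : Type} (F : set_system T) {FF : Filter F} (n : nat)
    (f : 'I_n -> T -> R) (l : 'I_n -> R) :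
  (forall i, f i x @[x --> F] --> l i) ->
  \sum_(i < n) f i x @[x --> F] --> \sum_(i < n) l i.
Proof. by move=> fl; apply: (cvg_big add_continuous) => i _; exact: fl. Qed.

(** * The cross product and the skew map [J] *)

Section Cross.
Context {R : realType}.
Implicit Types (c : R) (k x y : 'rV[R]_3).

Lemma ordS3K (i : 'I_3) : ordS (ordS (ordS i)) = i.
Proof. by apply/val_inj; case: i => -[|[|[|]]]. Qed.

Lemma ord3P (i : 'I_3) : [\/ i = ord0, i = ordS ord0 | i = ordS (ordS ord0)].
Proof.
by case: i => -[|[|[|//]]] i; [apply: Or31|apply: Or32|apply: Or33]; apply/val_inj.
Qed.

Lemma sum_ord3 (F : 'I_3 -> R) :
  \sum_i F i = F ord0 + F (ordS ord0) + F (ordS (ordS ord0)).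
Proof.
by rewrite !big_ord_recr big_ord0 /= add0r; congr (F _ + F _ + F _);
  apply/val_inj.
Qed.

Lemma rowP3 x y : x 0 ord0 = y 0 ord0 -> x 0 (ordS ord0) = y 0 (ordS ord0) ->
  x 0 (ordS (ordS ord0)) = y 0 (ordS (ordS ord0)) -> x = y.
Proof. by move=> *; apply/rowP => i; case: (ord3P i) => ->. Qed.

Lemma JmapD k x y : Jmap k (x + y) = Jmap k x + Jmap k y.
Proof. by apply/rowP => i; rewrite !mxE; ring. Qed.

Lemma JmapZ k c x : Jmap k (c *: x) = c *: Jmap k x.
Proof. by apply/rowP => i; rewrite !mxE; ring. Qed.

Lemma JmapN k x : Jmap k (- x) = - Jmap k x.
Proof. by rewrite -scaleN1r JmapZ scaleN1r. Qed.

Lemma Jmapkk k : Jmap k k = 0.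
Proof. by apply/rowP => i; rewrite !mxE; ring. Qed.

Lemma dot_Jmapl k x y : dot (Jmap k x) y = - dot x (Jmap k y).
Proof. by rewrite /dot !sum_ord3 !mxE !ordS3K; ring. Qed.

Lemma dot_Jmapxx k x : dot (Jmap k x) x = 0.
Proof. by rewrite /dot !sum_ord3 !mxE !ordS3K; ring. Qed.

(** Triple product formula; for a unit [k], [J^2] is minus the projection orthogonal to [k]. *)
Lemma JmapJmap k x : Jmap k (Jmap k x) = dot k x *: k - dot k k *: x.
Proof. by apply: rowP3; rewrite /dot !sum_ord3 !mxE ?ordS3K; ring. Qed.

Definition Jmx k : 'M[R]_3 := \matrix_(i, j) Jmap k (delta_mx 0 i) 0 j.

Lemma mul_Jmx k x : x *m Jmx k = Jmap k x.
Proof.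
apply: rowP3; rewrite !mxE !sum_ord3 !mxE ?ordS3K /=; ring.
Qed.

End Cross.

(** * Strong monotonicity and surjectivity of [F_z] *)

Section FluxFunction.
Context {R : realType} (N : nat) (alpha a : nat -> R) (k : 'rV[R]_3).
Hypothesis alpha0 : alpha 0%N = 0.
Hypothesis alpha_lt : forall i : nat, (i < N)%N -> alpha i < alpha i.+1.
Hypothesis a_gt0 : forall i : nat, (i <= N)%N -> 0 < a i.
Hypothesis k1 : enorm k = 1.
Implicit Types (r s t z : R) (v w y : 'rV[R]_3).

Notation g := (gfun N a alpha).
Notation F := (Ffun N a alpha k).

Lemma alpha_ge0 (i : nat) : (i <= N)%N -> 0 <= alpha i.
Proof.
elim: i => [_|i IH iN]; first by rewrite alpha0.
by apply: le_trans (IH (ltnW iN)) _; apply/ltW/alpha_lt.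
Qed.

(** The exponent-zero term contributes [a 0] at every [s], even at [0], since [0^0 = 1]. This is the
    constant of the coercivity bounds below. *)
Lemma gfun_ge s : a 0%N <= g s.
Proof.
rewrite /gfun big_ord_recl /= alpha0 powRr0 mulr1 lerDl; apply: sumr_ge0 => i _.
by rewrite mulr_ge0 ?powR_ge0 ?ltW ?a_gt0.
Qed.

Lemma gfun_gt0 s : 0 < g s.
Proof. by apply: lt_le_trans (gfun_ge s); exact: a_gt0. Qed.

Lemma gfun_le s t : 0 <= s -> s <= t -> g s <= g t.
Proof.
move=> s0 st; apply: ler_sum => i _; have iN : (i <= N)%N by rewrite -ltnS.
rewrite ler_wpM2l ?(ltW (a_gt0 iN)) // ge0_ler_powR ?alpha_ge0 // nnegrE //.
exact: le_trans st.
Qed.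

(** The [J] part drops out by skew-symmetry, so the constant is uniform in [z]. The radial part is
    handled by subtracting [a 0] from [g]. *)
Lemma Ffun_monotone z v w :
  a 0%N * dot (v - w) (v - w) <= dot (F z v - F z w) (v - w).
Proof.
have -> : F z v - F z w =
    (g (enorm v) *: v - g (enorm w) *: w) + z *: Jmap k (v - w).
  by rewrite JmapD JmapN scalerDr scalerN /Ffun opprD addrACA.
rewrite [leRHS]dotDl dotZl dot_Jmapxx mulr0 addr0.
rewrite !(dotDl, dotDr, dotNl, dotNr, dotZl) (dotC w v).
have := dot_le_enorm v w; rewrite -!sqr_enorm.
have := enorm_ge0 v; have := enorm_ge0 w.
have := @gfun_le (enorm v) (enorm w); have := @gfun_le (enorm w) (enorm v).
have := gfun_ge (enorm v); have := gfun_ge (enorm w).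
move: (enorm v) (enorm w) (dot v w) (a 0%N) => p q d a0.
move: (g p) (g q) => P Q aQ aP QP PQ q0 p0 dpq.
have h : 0 <= (P - a0) * p ^+ 2 + (Q - a0) * q ^+ 2
               - (P - a0 + (Q - a0)) * d.
  (* [m] uses [v.w <= |v| |w|], and [e] that [s (g s - a 0)] is nondecreasing for [s >= 0]; their
     sum is the right side of [h]. *)
  have m : 0 <= (P - a0 + (Q - a0)) * (p * q - d) by apply: mulr_ge0; lra.
  have e : 0 <= ((P - a0) * p - (Q - a0) * q) * (p - q).
    have [pq|/ltW qp] := leP p q.
      have PQ' := PQ p0 pq.
      have e1 : 0 <= (Q - P) * q by apply: mulr_ge0; lra.
      have e2 : 0 <= (P - a0) * (q - p) by apply: mulr_ge0; lra.
      by rewrite -mulrNN; apply: mulr_ge0; lra.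
    have PQ' := QP q0 qp.
    have e1 : 0 <= (P - Q) * p by apply: mulr_ge0; lra.
    have e2 : 0 <= (Q - a0) * (p - q) by apply: mulr_ge0; lra.
    by apply: mulr_ge0; lra.
  have := addr_ge0 m e; congr (0 <= _); ring.
rewrite -subr_ge0; move: h; congr (0 <= _); ring.
Qed.

Lemma Ffun_expanding z v w : a 0%N * enorm (v - w) <= enorm (F z v - F z w).
Proof.
have [/eqP->|vw] := boolP (v - w == 0).
  by rewrite (eqP (_ : enorm 0 == 0)) ?enorm_eq0 // mulr0 enorm_ge0.
have e0 : 0 < enorm (v - w) by rewrite lt_neqAle enorm_ge0 eq_sym enorm_eq0 vw.
rewrite -(ler_pM2r e0) -mulrA -expr2 sqr_enorm.
exact: le_trans (Ffun_monotone z v w) (dot_le_enorm _ _).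
Qed.

(* [`|r|] because [powR] takes the junk value [1] at negative reals, which breaks the
   continuity of [g] itself at [0]. *)
Lemma continuous_powR_norm (p : R) : 0 <= p -> continuous (fun r : R => `|r| `^ p).
Proof.
rewrite le_eqVlt => /predU1P[<-|p0] r.
  have -> : (fun r : R => `|r| `^ 0) = cst 1 by apply/funext => s; rewrite powRr0.
  exact: cvg_cst.
have [->|r0] := eqVneq r 0; last first.
  apply: (@continuous_comp _ _ _ (@Num.norm R R) (fun s => s `^ p)).
    exact: norm_continuous.
  apply/differentiable_continuous/derivable1_diffP/derivable_powR.
  by rewrite in_itv /= andbT normr_gt0.
apply/cvgrPdist_lt => e e0; rewrite normr0 powR0 ?gt_eqF //.
near=> s; rewrite sub0r normrN ger0_norm ?powR_ge0 //.
rewrite -[ltRHS](powRr1 (ltW e0)) -(mulVf (lt0r_neq0 p0)) powRrM.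
apply: gt0_ltr_powR => //; rewrite ?nnegrE ?powR_ge0 //.
near: s; exists (e `^ p^-1) => /=; first exact: powR_gt0.
by move=> s /=; rewrite sub0r normrN.
Unshelve. all: by end_near. Qed.

Lemma continuous_gfun_norm : continuous (fun r : R => g `|r|).
Proof.
move=> r; rewrite /gfun /=; apply: cvg_sum => i.
apply: cvgM; first exact: cvg_cst.
by apply: continuous_powR_norm; rewrite alpha_ge0 // -ltnS.
Qed.

(* Inverse of [s I + z J], using [J^3 = - J] for a unit vector [k]. *)
Definition resolvent s z y : 'rV[R]_3 :=
  (s^-1 * dot k y) *: k +
  (s ^+ 2 + z ^+ 2)^-1 *: (s *: (y - dot k y *: k) - z *: Jmap k y).

(** Along [k] the map is multiplication by [s]; on the orthogonal plane [J^2 = -1], so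
    [(s + z J)(s - z J) = s^2 + z^2]. *)
Lemma resolventK s z y : 0 < s ->
  s *: resolvent s z y + z *: Jmap k (resolvent s z y) = y.
Proof.
move=> s0; have kk : dot k k = 1 by rewrite -sqr_enorm k1 expr1n.
have d0 : s ^+ 2 + z ^+ 2 != 0 by rewrite gt_eqF // ltr_pwDl ?sqr_ge0 ?exprn_gt0.
rewrite /resolvent.
rewrite !(JmapD, JmapN, JmapZ) Jmapkk JmapJmap kk.
apply/rowP => i; rewrite !mxE; field.
by rewrite d0 gt_eqF.
Qed.

(** Once [r = |v|] is frozen the equation is linear and [resolvent] solves it; the intermediate
    value theorem then finds [r] with [enorm (V r) = r]. *)
Lemma Ffun_surj z y : exists v, F z v = y.
Proof.
pose V r := resolvent (g `|r|) z y.
pose f r := dot (V r) (V r) - r ^+ 2.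
have cV i : continuous (fun r => V r 0 i).
  have -> : (fun r => V r 0 i) = (fun r => (g `|r|)^-1 * dot k y * k 0 i +
     ((g `|r|) ^+ 2 + z ^+ 2)^-1 * (g `|r| * (y 0 i - dot k y * k 0 i)
        - z * Jmap k y 0 i)).
    by apply/funext => r; rewrite /V /resolvent !mxE.
  have cg := continuous_gfun_norm.
  move=> r; apply: cvgD.
    by do 2 (apply: cvgM; last exact: cvg_cst); apply: cvgV;
       [rewrite gt_eqF ?gfun_gt0 | exact: cg].
  apply: cvgM.
    apply: cvgV; last by apply: cvgD; [exact: cvgM (cg r) (cg r) | exact: cvg_cst].
    by rewrite gt_eqF // ltr_pwDl ?sqr_ge0 ?exprn_gt0 ?gfun_gt0.
  apply: cvgB; last exact: cvg_cst.
  by apply: cvgM (cg r) _; exact: cvg_cst.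
have cf : continuous f.
  move=> r; apply: cvgB; last exact: exprn_continuous.
  by apply: cvg_sum => i; apply: cvgM; exact: cV.
have a0 := a_gt0 (leq0n N).
(* Pairing the linear equation with [v = V r] gives [a 0 |v|^2 <= y.v <= |y| |v|], so [|V r| <= M]
   for all [r]. *)
pose M := enorm y / a 0%N.
have M0 : 0 <= M by rewrite divr_ge0 ?enorm_ge0 ?ltW.
have le_enV r : enorm (V r) <= M.
  rewrite ler_pdivlMr // mulrC; set v := V r.
  have := dot_le_enorm y v; rewrite -{1}(resolventK z y (gfun_gt0 `|r|)) -/(V r) -/v.
  rewrite dotDl !dotZl dot_Jmapxx mulr0 addr0 -sqr_enorm.
  have [-> _|v0] := eqVneq (enorm v) 0; first by rewrite mulr0 enorm_ge0.
  have vp : 0 < enorm v by rewrite lt_neqAle enorm_ge0 eq_sym v0.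
  rewrite expr2 mulrA ler_pM2r //; apply: le_trans.
  by rewrite ler_pM2r // gfun_ge.
have [r] : exists2 r, r \in `[0, M]%R & f r = 0.
  apply: IVT => //; first exact: continuous_subspaceT.
  have f0 : 0 <= f 0 by rewrite /f expr0n subr0 dotxx_ge0.
  have fM : f M <= 0.
    by rewrite /f subr_le0 -sqr_enorm ler_sqr ?nnegrE ?enorm_ge0.
  by rewrite ge_min le_max f0 fM orbT.
rewrite in_itv /= => /andP[r0 _] /eqP; rewrite subr_eq0 -sqr_enorm.
rewrite eqrXn2 ?enorm_ge0 // => /eqP Vr.
exists (V r); rewrite /Ffun Vr -[X in g X](ger0_norm r0); apply: resolventK.
exact: gfun_gt0.
Qed.

(** Surjectivity makes the set under [xget] nonempty, so the default value [0] does not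
    intervene. *)
Lemma Ffun_Xfun Rs z y : F (Rs * z) (Xfun N a alpha k Rs z y) = y.
Proof.
have [v Fv] := Ffun_surj (Rs * z) y.
by apply: (@xgetPex _ 0 [set v | F (Rs * z) v = y]); exists v.
Qed.

End FluxFunction.

Lemma is_derive0P {R : realType} (f : R -> R) (l : R) :
  is_derive (0 : R) 1 f l <-> h^-1 * (f h - f 0) @[h --> (0 : R)^'] --> l.
Proof.
have -> : (fun h => h^-1 * (f h - f 0)) =
    (fun h => h^-1 *: ((f \o shift 0) (h *: (1 : R)) - f 0)).
  by apply/funext => h; rewrite /= addr0 /GRing.scale /= mulr1.
split=> [[d <-]|lim]; first exact: d.
by apply: DeriveDef; [apply/cvg_ex; exists l | exact/cvg_lim].
Qed.

Lemma is_derive_affine {R : realType} (c b x : R) :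
  is_derive x 1 (fun t : R => c + t * b) b.
Proof.
have -> : (fun t : R => c + t * b) = cst c + b *: (id : R -> R).
  by apply/funext => t; rewrite !fctE /GRing.scale /= mulrC.
have := is_deriveD (is_derive_cst c x 1) (is_deriveZ b (is_derive_id x 1)).
by rewrite add0r /GRing.scale /= mulr1.
Qed.

(** * The Jacobian of [F_z] and the derivative of its inverse *)

Section FluxDerivative.
Context {R : realType} (N : nat) (alpha a : nat -> R) (k : 'rV[R]_3).
Hypothesis alpha0 : alpha 0%N = 0.
Hypothesis alpha_lt : forall i : nat, (i < N)%N -> alpha i < alpha i.+1.
Hypothesis a_gt0 : forall i : nat, (i <= N)%N -> 0 < a i.
Implicit Types (r s t z : R) (v w y : 'rV[R]_3).

Notation g := (gfun N a alpha).
Notation F := (Ffun N a alpha k).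

Definition dgfun s := \sum_(i < N.+1) a i * (alpha i * s `^ (alpha i - 1)).

Lemma dgfun_ge0 s : 0 <= dgfun s.
Proof.
apply: sumr_ge0 => i _; have iN : (i <= N)%N by rewrite -ltnS.
by rewrite !mulr_ge0 ?powR_ge0 ?(ltW (a_gt0 iN)) ?(alpha_ge0 alpha0 alpha_lt).
Qed.

Lemma is_derive_gfun s : 0 < s -> is_derive s 1 g (dgfun s).
Proof.
move=> s0.
have -> : g = \sum_(i < N.+1) (a i *: (fun r => r `^ alpha i)).
  by apply/funext => r; rewrite fct_sumE.
by apply: is_derive_sum => i; apply: is_deriveZ; exact: is_derive1_powR.
Qed.

(* At the origin [g (enorm v)] need not be differentiable, but [g (enorm v) *: v] is. *)
Lemma is_derive_radial v w (i : 'I_3) :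
  is_derive (0 : R) 1
    (fun t => (g (enorm (v + t *: w)) *: (v + t *: w)) 0 i)
    ((g (enorm v) *: w + (dgfun (enorm v) / enorm v * dot v w) *: v) 0 i).
Proof.
have [->|v0] := eqVneq v 0.
  have e0 : enorm (0 : 'rV[R]_3) = 0 by apply/eqP; rewrite enorm_eq0.
  rewrite scaler0 addr0 mxE.
  have -> : (fun t => (g (enorm (0 + t *: w)) *: (0 + t *: w)) 0 i)
      = fun t => g (`|t * enorm w|) * (t * w 0 i).
    apply/funext => t; rewrite add0r !mxE enormZ normrM.
    by rewrite (ger0_norm (enorm_ge0 w)).
  (* At the origin the difference quotient is [g(|h| |w|) w_i], so continuity of [g] on norms is
     enough. *)
  apply/is_derive0P.
  have : (fun h => g `|h * enorm w| * w 0 i) @ (0 : R)^' -->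
        g (enorm (0 : 'rV[R]_3)) * w 0 i.
      apply: cvgM; last exact: cvg_cst.
      have cg : continuous (fun h : R => g `|h * enorm w|).
        move=> h.
        have c2 := @continuous_gfun_norm R N alpha a alpha0 alpha_lt (h * enorm w).
        have c1 := @mulrr_continuous R (enorm w) h.
        exact: continuous_comp c1 c2.
      rewrite [X in g X](_ : _ = `|0 * enorm w|); last by rewrite e0 mul0r normr0.
      by apply: cvg_trans (cg 0); apply: cvg_app; exact: cvg_within.
    apply: cvg_trans; apply: near_eq_cvg; near=> h.
  rewrite !mul0r mulr0 subr0.
  by rewrite [_^-1 * _]mulrCA mulKf //; near: h; exact: nbhs_dnbhs_neq.
have v_gt0 : 0 < enorm v by rewrite lt_neqAle enorm_ge0 eq_sym enorm_eq0 v0.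
pose q t := dot v v + 2 * t * dot v w + t ^+ 2 * dot w w.
have qE t : enorm (v + t *: w) = Num.sqrt (q t).
  rewrite enormE; congr Num.sqrt.
  by rewrite /q !(dotDl, dotDr, dotZl, dotZr) (dotC w v); ring.
have q0 : q 0 = enorm v ^+ 2 by rewrite /q sqr_enorm; ring.
have dq : is_derive (0 : R) 1 q (2 * dot v w).
  have -> : q = cst (dot v v) + (2 * dot v w) *: id + (dot w w) *: (id ^+ 2).
    apply/funext => t; rewrite /q !fctE /=; rewrite /GRing.scale /=; ring.
  apply: is_derive_eq.
  rewrite /GRing.scale /= expr1 !mulr1 add0r; ring.
have dn : is_derive (0 : R) 1 (fun t => enorm (v + t *: w)) (dot v w / enorm v).
  have -> : (fun t => enorm (v + t *: w)) = Num.sqrt \o q by apply/funext => t; rewrite /= qE.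
  have d1 : is_derive (q 0) 1 Num.sqrt (2 * Num.sqrt (q 0))^-1.
    by apply: is_derive1_sqrt; rewrite q0 exprn_gt0.
  apply: (is_derive_eq (@is_derive1_comp _ Num.sqrt q 0 _ _ d1 dq)); rewrite q0 sqrtr_sqr gtr0_norm //.
  by rewrite /GRing.scale /=; field; rewrite gt_eqF.
have dg : is_derive (0 : R) 1 (fun t => g (enorm (v + t *: w)))
    (dgfun (enorm v) * (dot v w / enorm v)).
  have d1 : is_derive (enorm (v + 0 *: w)) 1 g (dgfun (enorm v)).
    by rewrite scale0r addr0; exact: is_derive_gfun.
  exact: (@is_derive1_comp _ g (fun t => enorm (v + t *: w)) 0 _ _ d1 dn).
have dv : is_derive (0 : R) 1 (fun t => (v + t *: w) 0 i) (w 0 i).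
  have -> : (fun t => (v + t *: w) 0 i) = (fun t => v 0 i + t * w 0 i).
    by apply/funext => t; rewrite !mxE.
  exact: is_derive_affine.
have -> : (fun t => (g (enorm (v + t *: w)) *: (v + t *: w)) 0 i) =
    (fun t => g (enorm (v + t *: w))) * (fun t => (v + t *: w) 0 i).
  by apply/funext => t; rewrite mxE.
apply: is_derive_eq (is_deriveM dg dv) _.
rewrite scale0r addr0 /GRing.scale /= !mxE; ring.
Unshelve. all: by end_near. Qed.

(** At [v = 0] the convention values of [dgfun] and of the division by zero multiply the vector [v],
    so the middle term is zero there, as in [is_derive_radial]. *)
Definition dFfun z v w : 'rV[R]_3 :=
  g (enorm v) *: w + (dgfun (enorm v) / enorm v * dot v w) *: v + z *: Jmap k w.

Lemma is_derive_Ffun z v w (i : 'I_3) :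
  is_derive (0 : R) 1 (fun t => F z (v + t *: w) 0 i) (dFfun z v w 0 i).
Proof.
have -> : (fun t => F z (v + t *: w) 0 i) =
   (fun t => (g (enorm (v + t *: w)) *: (v + t *: w)) 0 i)
     + (fun t => z * Jmap k v 0 i + t * (z * Jmap k w 0 i)).
  apply/funext => t; rewrite /Ffun JmapD JmapZ !fctE.
  by move: (g _) => c; rewrite !mxE; ring.
apply: is_derive_eq (is_deriveD (is_derive_radial v w i) (is_derive_affine _ _ _)) _.
by rewrite /dFfun [RHS]mxE [X in _ = _ + X]mxE.
Qed.

Definition dFmx z v : 'M[R]_3 :=
  (g (enorm v))%:M + (dgfun (enorm v) / enorm v) *: (v^T *m v) + z *: Jmx k.

Lemma mul_dFmx z v w : w *m dFmx z v = dFfun z v w.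
Proof.
rewrite /dFmx !mulmxDr -!scalemxAr mul_mx_scalar mul_Jmx; congr (_ + _ + _).
rewrite -scalerA; congr (_ *: _); rewrite mulmxA [w *m _]mx11_scalar mul_scalar_mx.
by congr (_ *: _); rewrite mxE dotC; apply: eq_bigr => j _; rewrite mxE.
Qed.

(** The rank-one term adds [g'(|v|) / |v| (v.w)^2 >= 0], and the [J] term adds nothing. *)
Lemma dFmx_coercive z v w : a 0%N * dot w w <= dot (w *m dFmx z v) w.
Proof.
rewrite mul_dFmx !dotDl !dotZl dot_Jmapxx mulr0 addr0 -[leLHS]addr0.
apply: lerD; first by rewrite ler_wpM2r ?dotxx_ge0 // gfun_ge.
by rewrite -mulrA mulr_ge0 ?divr_ge0 ?dgfun_ge0 ?enorm_ge0 // -expr2 sqr_ge0.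
Qed.

Lemma dFmx_unit z v : dFmx z v \in unitmx.
Proof.
rewrite -row_free_unit -kermx_eq0; apply/eqP/row_matrixP => i; rewrite row0.
set w := row i _; have := dFmx_coercive z v w.
have -> : w *m dFmx z v = 0 by apply/sub_kermxP; exact: row_sub.
rewrite dot0l pmulr_rle0; last exact: a_gt0.
by move=> w0; apply/eqP; rewrite -dotxx_eq0 eq_le w0 dotxx_ge0.
Qed.

(** With [x = y B], the form of the inverse of [B] at [x] is the form of [B] at [y]. *)
Lemma psd_invmx_dFmx z v : psd (invmx (dFmx z v)).
Proof.
move=> x; rewrite dotC -{1}(mulmxKV (dFmx_unit z v) x).
apply: le_trans (dFmx_coercive z v _).
by rewrite mulr_ge0 ?dotxx_ge0 // ltW // a_gt0.
Qed.

Lemma is_derive_le_sum (n : nat) (C : R) (f : R -> R) (psi : 'I_n -> R -> R) :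
  (forall i, psi i 0 = 0) -> (forall i, is_derive (0 : R) 1 (psi i) 0) ->
  (forall h, `|f h| <= C * \sum_i `|psi i h|) -> is_derive (0 : R) 1 f 0.
Proof.
move=> psi0 dpsi fle.
have f0 : f 0 = 0.
  apply/eqP; rewrite -normr_le0; apply: le_trans (fle 0) _.
  by rewrite big1 ?mulr0 // => i _; rewrite psi0 normr0.
apply: (is_derive0P f 0).2; apply/norm_cvg0P.
have : C * \sum_i `|h^-1 * psi i h| @[h --> (0 : R)^'] --> C * \sum_(i < n) (0 : R).
  apply: cvgM; first exact: cvg_cst.
  apply: cvg_sum => i; rewrite -[X in _ --> X](normr0 R); apply: cvg_norm.
  have := (is_derive0P _ _).1 (dpsi i); rewrite psi0.
  by under eq_fun do rewrite subr0.
rewrite big1 // mulr0; apply: squeeze_cvgr; last exact: cvg_cst.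
apply: nearW => h /=; rewrite normr_ge0 f0 subr0 normrM.
under eq_bigr do rewrite normrM.
by rewrite -mulr_sumr mulrCA ler_wpM2l.
Qed.

(* With [w] the expected derivative, [V h] is compared with [V 0 + h w]: since
   [F z] is expanding, the error is at most [(a 0)^-1 * |y h - F (z h) (V 0 + h w)|],
   which has zero derivative at [h = 0]; no implicit function theorem is needed. *)
Lemma is_derive_Finv (zeta : R -> R) (y V : R -> 'rV[R]_3) (dy : 'rV[R]_3) :
  (forall h, F (zeta h) (V h) = y h) ->
  is_derive (0 : R) 1 zeta 0 ->
  (forall i, is_derive (0 : R) 1 (fun h => y h 0 i) (dy 0 i)) ->
  forall i, is_derive (0 : R) 1 (fun h => V h 0 i)
     ((dy *m invmx (dFmx (zeta 0) (V 0))) 0 i).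
Proof.
move=> FV dz dyi i; set w := dy *m _.
have Lw : dFfun (zeta 0) (V 0) w = dy by rewrite -mul_dFmx mulmxKV ?dFmx_unit.
pose psi j h := (y h - F (zeta h) (V 0 + h *: w)) 0 j.
have a0 : 0 < a 0%N by exact: a_gt0.
pose f h := V h 0 i - (V 0 0 i + h * w 0 i).
have df : is_derive (0 : R) 1 f 0.
  apply: (@is_derive_le_sum _ (a 0%N)^-1 _ psi).
  - by move=> j; rewrite /psi scale0r addr0 FV subrr mxE.
  - move=> j.
    (* The variation of [zeta] is isolated in a factor with value and derivative [0] at [0]; by the
       choice of [w], the derivatives of the other two terms cancel. *)
    have -> : psi j = (fun h => y h 0 j) - (fun h => F (zeta 0) (V 0 + h *: w) 0 j)
        - (zeta - cst (zeta 0)) * (fun t => Jmap k (V 0) 0 j + t * Jmap k w 0 j).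
      apply/funext => h; rewrite /psi /Ffun !fctE JmapD JmapZ; move: (g _) => c.
      by rewrite !mxE; ring.
    have d1 := is_derive_Ffun (zeta 0) (V 0) w j; rewrite Lw in d1.
    have dz0 := is_deriveB dz (is_derive_cst (zeta 0) (0 : R) (1 : R)).
    have d3 := is_deriveM dz0 (is_derive_affine (Jmap k (V 0) 0 j) (Jmap k w 0 j) 0).
    apply: is_derive_eq (is_deriveB (is_deriveB (dyi j) d1) d3) _.
    by rewrite !fctE /= /GRing.scale /=; ring.
  - move=> h.
    rewrite mulrC ler_pdivlMr // mulrC.
    have e1 : `|f h| <= enorm (V h - (V 0 + h *: w)).
      by apply: le_trans _ (coord_le_enorm _ i); rewrite /f !mxE.
    apply: le_trans (ler_wpM2l (ltW a0) e1) _.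
    apply: le_trans (Ffun_expanding k alpha0 alpha_lt a_gt0 (zeta h) _ _) _.
    rewrite FV.
    rewrite -[leRHS]ger0_norm ?sumr_ge0 // -sqrtr_sqr ler_sqrt ?sqr_ge0 //.
    under eq_bigr do rewrite -/(psi _ h) -real_normK ?num_real //.
    rewrite /psi sum_ord3 [X in _ <= X ^+ 2]sum_ord3.
    move: (normr_ge0 (psi ord0 h)) (normr_ge0 (psi (ordS ord0) h)).
    move: (normr_ge0 (psi (ordS (ordS ord0)) h)); rewrite /psi.
    move: `|_| `|_| `|_| => p q r; nra.
have -> : (fun h => V h 0 i) = f + (fun h => V 0 0 i + h * w 0 i).
  by apply/funext => h; rewrite !fctE /f subrK.
by apply: is_derive_eq (is_deriveD df (is_derive_affine _ _ _)) _; rewrite add0r.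
Qed.

End FluxDerivative.

(** * Directional derivatives along lines and from partial derivatives *)

Section Lines.
Context {R : realType} {n : nat}.
Implicit Types (f : 'rV[R]_n -> R) (x y v b : 'rV[R]_n).

Lemma is_derive_line f x v t : derivable f (x + t *: v) v ->
  is_derive t 1 (fun s : R => f (x + s *: v)) ('D_v f (x + t *: v)).
Proof.
have e : (fun h : R => h^-1 *:
      (((fun s : R => f (x + s *: v)) \o shift t) (h *: (1 : R)) - f (x + t *: v)))
   = (fun h : R => h^-1 *: ((f \o shift (x + t *: v)) (h *: v) - f (x + t *: v))).
  apply/funext => h /=; congr (_ *: (f _ - _)).
  by rewrite [h *: 1]mulr1 scalerDl addrCA.
move=> d; apply: DeriveDef; first by rewrite /derivable e.
by rewrite /derive e.
Qed.

Lemma is_derive_at_line f x v l :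
  is_derive (0 : R) 1 (fun s : R => f (x + s *: v)) l -> is_derive x v f l.
Proof.
have e : (fun h : R => h^-1 *:
      (((fun s : R => f (x + s *: v)) \o shift 0) (h *: (1 : R)) - f (x + 0 *: v)))
   = (fun h : R => h^-1 *: ((f \o shift x) (h *: v) - f x)).
  apply/funext => h /=; rewrite scale0r !addr0 [h *: 1]mulr1.
  by rewrite [x + _]addrC.
move=> [d1 d2]; apply: DeriveDef; first by move: d1; rewrite /derivable e.
by rewrite -d2 /derive e.
Qed.

Lemma is_derive_translate f b x v : derivable f (x + b) v ->
  is_derive x v (fun y => f (y + b)) ('D_v f (x + b)).
Proof.
have e : (fun h : R => h^-1 *:
      (((fun y => f (y + b)) \o shift x) (h *: v) - f (x + b)))
   = (fun h : R => h^-1 *: ((f \o shift (x + b)) (h *: v) - f (x + b))).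
  by apply/funext => h /=; rewrite addrA.
move=> d; apply: DeriveDef; first by rewrite /derivable e.
by rewrite /derive e.
Qed.

Lemma MVT_line f x v c :
  (forall s : R, `|s| <= `|c| -> derivable f (x + s *: v) v) ->
  exists2 s : R, `|s| <= `|c| & f (x + c *: v) - f x = c * 'D_v f (x + s *: v).
Proof.
move=> df; pose phi (s : R) := f (x + s *: v).
have dphi (s : R) : `|s| <= `|c| -> is_derive s (1 : R) phi ('D_v f (x + s *: v)).
  by move=> sc; apply: is_derive_line; exact: df.
have mvt (a b : R) : a <= b -> (forall s, s \in `[a, b] -> `|s| <= `|c|) ->
    exists2 s, s \in `[a, b] & phi b - phi a = 'D_v f (x + s *: v) * (b - a).
  move=> ab sub.
  apply: (@MVT_segment R phi (fun s => 'D_v f (x + s *: v))) => //.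
    move=> s sab; apply/dphi/sub; exact: subset_itv_oo_cc.
  apply: derivable_within_continuous => s /sub sc.
  by have [] := dphi _ sc.
have [c0|c0] := leP 0 c.
  have [|s] := mvt 0 c c0.
    by move=> s; rewrite in_itv /= => /andP[s0 sc]; rewrite !ger0_norm // (le_trans s0).
  rewrite in_itv /= => /andP[s0 sc] e; exists s; first by rewrite !ger0_norm.
  by move: e; rewrite /phi scale0r addr0 subr0 mulrC.
have [|s] := mvt c 0 (ltW c0).
  move=> s; rewrite in_itv /= => /andP[cs s0].
  by rewrite !ler0_norm ?lerN2 // ltW.
rewrite in_itv /= => /andP[cs s0] e; exists s.
  by rewrite !ler0_norm ?lerN2 // ltW.
move: e; rewrite /phi scale0r addr0 sub0r mulrN => e.
by rewrite -opprB e opprK mulrC.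
Qed.

Lemma norm_ev (i : 'I_n) : `|ev i : 'rV[R]_n| <= 1.
Proof.
rewrite [leLHS]/Num.Def.normr /= mx_normrE (bigmax_le _ ler01) // => -[j l] _ /=.
by rewrite mxE; case: (_ && _); rewrite ?normr0 ?normr1.
Qed.

(** The increment is split coordinate by coordinate; the mean value theorem turns each piece into a
    partial derivative at a point close to [x], where continuity applies. *)
Lemma is_derive_partials f x v :
  (\forall y \near x, forall i, derivable f y (ev i)) ->
  (forall i, {for x, continuous (fun y => 'D_(ev i) f y)}) ->
  is_derive x v f (\sum_i v 0 i * 'D_(ev i) f x).
Proof.
move=> df cf; apply: is_derive_at_line; apply: (is_derive0P _ _).2.
rewrite scale0r addr0.
(* One radius [d] serves every list [s] of indices, so that induction on [s] adds one coordinate at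
   a time. *)
have main (e : R) : 0 < e -> exists2 d : R, 0 < d &
  forall (s : seq 'I_n) (h : R), `|h| * (\sum_(i <- s) `|v 0 i|) < d ->
  `|f (x + h *: \sum_(i <- s) v 0 i *: ev i) - f x
     - h * \sum_(i <- s) v 0 i * 'D_(ev i) f x| <= `|h| * e * \sum_(i <- s) `|v 0 i|.
  move=> e0.
  have : \forall y \near x, (forall i, derivable f y (ev i)) /\
      forall i, `|'D_(ev i) f x - 'D_(ev i) f y| <= e.
    have near_e : \forall y \near x, forall i, `|'D_(ev i) f x - 'D_(ev i) f y| <= e.
      apply: (@filter_forall _ 'I_n (fun i y => `|'D_(ev i) f x - 'D_(ev i) f y| <= e)
        (nbhs x) (nbhs_filter x)) => i.
      by have /cvgrPdist_le /(_ e e0) := cf i.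
    exact: filterI df near_e.
  move=> /nbhs_ballP[d /= d0 ball_d]; exists d => //.
  elim=> [|i s IH] h; first by rewrite !big_nil scaler0 addr0 !mulr0 !subrr normr0.
  rewrite !big_cons => hd.
  have Si := normr_ge0 (v 0 i).
  have Ss : 0 <= \sum_(i <- s) `|v 0 i| by apply: sumr_ge0.
  have hs : `|h| * \sum_(i <- s) `|v 0 i| < d.
    by apply: le_lt_trans hd; rewrite ler_wpM2l // lerDr.
  set w := \sum_(i <- s) v 0 i *: ev i.
  have nw : `|w| <= \sum_(i <- s) `|v 0 i|.
    apply: le_trans (ler_norm_sum _ _ _) _; apply: ler_sum => j _.
    by rewrite normrZ ler_piMr ?norm_ev.
  have inb r : `|r| <= `|h * v 0 i| -> ball x d (x + h *: w + r *: ev i).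
    move=> r_le; rewrite -ball_normE /= -addrA opprD addNKr normrN.
    apply: le_lt_trans hd; apply: le_trans (ler_normD _ _) _.
    rewrite addrC mulrDr; apply: lerD.
      rewrite normrZ -[leRHS]mulr1; apply: ler_pM => //; last exact: norm_ev.
      by rewrite -normrM.
    by rewrite normrZ ler_wpM2l.
  have [|r r_le mv] := @MVT_line f (x + h *: w) (ev i) (h * v 0 i).
    by move=> r r_le; have [/(_ i)] := ball_d _ (inb _ r_le).
  have -> : x + h *: (v 0 i *: ev i + w) = x + h *: w + (h * v 0 i) *: ev i.
    by rewrite scalerDr scalerA addrAC addrA.
  have [_ /(_ i) close] := ball_d _ (inb _ r_le).
  have := IH _ hs; rewrite -/w => ih.
  set D := 'D_(ev i) f x in close *; set D' := 'D_(ev i) f _ in close mv *.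
  set S := \sum_(j <- s) v 0 j * _ in ih *.
  have -> : f (x + h *: w + (h * v 0 i) *: ev i) - f x - h * (v 0 i * D + S) =
     (f (x + h *: w) - f x - h * S) - (h * v 0 i) * (D - D').
    move/eqP: mv; rewrite subr_eq => /eqP ->; ring.
  apply: le_trans (ler_normB _ _) _; rewrite [leRHS]mulrDr [leRHS]addrC; apply: lerD => //.
  by rewrite !normrM mulrAC; apply: ler_wpM2r => //; apply: ler_wpM2l.
have wE : v = \sum_(i <- index_enum 'I_n) v 0 i *: ev i by rewrite -row_sum_delta.
set L := \sum_i _.
apply/cvgrPdist_le => e e0.
pose S := \sum_(i <- index_enum 'I_n) `|v 0 i|.
have S0 : 0 <= S by apply: sumr_ge0.
have S1 : 0 < S + 1 by rewrite ltr_wpDl.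
(* The [+ 1] keeps the denominator positive when [v = 0]. *)
have [d d0 Hd] := main (e / (S + 1)) (divr_gt0 e0 S1).
near=> h.
have h0 : h != 0 by near: h; exact: nbhs_dnbhs_neq.
have hn : 0 < `|h| by rewrite normr_gt0.
have hd : `|h| * S < d.
  have : `|h| < d / (S + 1).
    near: h; apply: dnbhs0_lt; exact: divr_gt0.
  rewrite ltr_pdivlMr //; apply: le_lt_trans; rewrite ler_wpM2l // lerDl //.
have := Hd _ _ hd; rewrite -wE -/L -/S => le1.
have -> : L - h^-1 * (f (x + h *: v) - f x) = - (h^-1 * (f (x + h *: v) - f x - h * L)).
  by field.
rewrite normrN normrM normfV mulrC ler_pdivrMr // [leRHS]mulrC.
apply: le_trans le1 _; rewrite -mulrA ler_wpM2l // mulrAC ler_pdivrMr //.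
by rewrite ler_wpM2l ?ltW // ltrDl.
Unshelve. all: by end_near. Qed.

End Lines.

(** * Symmetry of the Hessian and second-order conditions at a maximum *)

Section SecondOrder.
Context {R : realType} {n : nat}.
Implicit Types (f : 'rV[R]_n -> R) (x y v : 'rV[R]_n).

(** If [K > 0], then [dphi] is positive just to the right of [0], and the mean value theorem makes
    [phi] exceed [phi 0] there. *)
Lemma second_derivative_max (phi dphi : R -> R) (d K : R) : 0 < d ->
  (forall s : R, `|s| < d -> is_derive s (1 : R) phi (dphi s)) ->
  (forall s : R, `|s| < d -> phi s <= phi 0) ->
  is_derive (0 : R) 1 dphi K -> dphi 0 = 0 /\ K <= 0.
Proof.
move=> d0 dp mp dK.
have inE s : s \in `]- d, d[ -> `|s| < d by rewrite in_itv /= ltr_norml.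
have dphi0 : dphi 0 = 0.
  have d1 : is_derive (0 : R) 1 phi 0.
    apply: (@derive1_at_max R phi (- d) d 0) => //.
    - by lra.
    - by move=> t /inE td; have [] := dp _ td.
    - by rewrite in_itv /= oppr_lt0 d0.
    - by move=> t /inE; exact: mp.
  have d2 : is_derive (0 : R) 1 phi (dphi 0) by apply: dp; rewrite normr0.
  by have [_ e1] := d1; have [_ e2] := d2; rewrite -e2 e1.
split=> //; rewrite leNgt; apply/negP => K0.
have /cvgrPdist_lt /(_ K K0) := (is_derive0P _ _).1 dK.
rewrite dphi0; under eq_near do rewrite subr0.
move=> /nbhs_ballP[e /= e0 He].
pose h := Num.min (d / 2) (e / 2).
have h0 : 0 < h by rewrite lt_min !divr_gt0.
have hd : h < d by rewrite gt_min ltr_pdivrMr // ltr_pMr // ltr1n.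
have he : h < e by rewrite gt_min orbC ltr_pdivrMr // ltr_pMr // ltr1n.
have pos s : 0 < s -> s <= h -> 0 < dphi s.
  move=> s0 sh; have : `|K - s^-1 * dphi s| < K.
    apply: He; last by rewrite gt_eqF.
    by rewrite /ball /= sub0r normrN gtr0_norm // (le_lt_trans sh).
  rewrite ltr_norml => /andP[_]; rewrite gtrDl oppr_lt0.
  by rewrite pmulr_rgt0 // invr_gt0.
have [c] : exists2 c, c \in `]0, h[ & phi h - phi 0 = dphi c * (h - 0).
  apply: MVT => //.
    move=> s; rewrite in_itv /= => /andP[s0 sh].
    by apply: dp; rewrite gtr0_norm // (lt_trans sh).
  apply: derivable_within_continuous => s; rewrite in_itv /= => /andP[s0 sh].
  have sd : `|s| < d by rewrite ger0_norm // (le_lt_trans sh).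
  by have [] := dp _ sd.
rewrite in_itv /= subr0 => /andP[c0 ch] e1.
have := mp h; rewrite gtr0_norm // => /(_ hd); rewrite -subr_le0 e1 leNgt.
by rewrite mulr_gt0 // pos // ltW.
Qed.

(** The first three clauses concern the nearby point [y], where the mean value theorem is applied;
    the second derivatives are continuous at the centre [x]. *)
Definition C2_at f x := \forall y \near x, forall i j : 'I_n,
  [/\ derivable f y (ev i), {for y, continuous (fun z => 'D_(ev i) f z)},
      derivable (fun z => 'D_(ev i) f z) y (ev j) &
      {for x, continuous (fun z => 'D_(ev j) (fun z => 'D_(ev i) f z) z)}].

Definition hessian f x : 'M[R]_n :=
  \matrix_(i, j) 'D_(ev j) (fun z => 'D_(ev i) f z) x.

(** The mean value theorem is used twice: along [ev i] for the increment in direction [ev j], then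
    along [ev j] for the [i]-th partial derivative. *)
Lemma hessian_double_increment f x (i j : 'I_n) (e : R) : C2_at f x -> 0 < e ->
  \forall h \near (0 : R)^',
    `|(f (x + h *: ev i + h *: ev j) - f (x + h *: ev i) - f (x + h *: ev j) + f x)
      / h ^+ 2 - hessian f x i j| <= e.
Proof.
move=> C2 e0.
have : \forall y \near x, `|hessian f x i j - 'D_(ev j) (fun z => 'D_(ev i) f z) y| <= e.
  have [_ _ _] := nbhs_singleton C2 i j.
  move=> /cvgrPdist_le /(_ e e0); rewrite /hessian mxE; exact.
move=> /(filterI C2) /nbhs_ballP[d /= d0 Hd].
have inb (h s r : R) : `|h| < d / 2 -> `|s| <= `|h| -> `|r| <= `|h| ->
    ball x d (x + s *: ev i + r *: ev j).
  move=> hd sh rh; rewrite -ball_normE /= -addrA opprD addNKr normrN.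
  apply: le_lt_trans (ler_normD _ _) _; rewrite !normrZ.
  have s1 : `|s| * `|ev i : 'rV[R]_n| <= `|s| by rewrite ler_piMr ?norm_ev.
  have r1 : `|r| * `|ev j : 'rV[R]_n| <= `|r| by rewrite ler_piMr ?norm_ev.
  rewrite [ltRHS]splitr; apply: ltr_leD; last exact: le_trans r1 (le_trans rh (ltW hd)).
  exact: le_lt_trans s1 (le_lt_trans sh hd).
near=> h.
have h0 : h != 0 by near: h; exact: nbhs_dnbhs_neq.
have hd : `|h| < d / 2 by near: h; apply: dnbhs0_lt; exact: divr_gt0.
pose psi y := f (y + h *: ev j) - f y.
have dpsi s : `|s| <= `|h| -> is_derive (x + s *: ev i) (ev i) psi
    ('D_(ev i) f (x + s *: ev i + h *: ev j) - 'D_(ev i) f (x + s *: ev i)).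
  move=> sh; have [/(_ i j)[d1 _ _ _] _] := Hd _ (inb h s h hd sh (lexx _)).
  have h00 : `|0 : R| <= `|h| by rewrite normr0.
  have [/(_ i j)[d2 _ _ _] _] := Hd _ (inb h s 0 hd sh h00).
  rewrite scale0r addr0 in d2.
  exact: is_deriveB (is_derive_translate d1) (derivableP d2).
have [|s sh e1] := @MVT_line _ _ psi x (ev i) h.
  by move=> s /dpsi[].
have [_ e2] := dpsi s sh; rewrite e2 in e1.
have [|r rh e3] := @MVT_line _ _ (fun z => 'D_(ev i) f z) (x + s *: ev i) (ev j) h.
  by move=> r rh; have [/(_ i j)[]] := Hd _ (inb h s r hd sh rh).
have [_ close] := Hd _ (inb h s r hd sh rh).
rewrite e3 mulrA -expr2 in e1.
have -> : f (x + h *: ev i + h *: ev j) - f (x + h *: ev i) - f (x + h *: ev j) + f x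
    = psi (x + h *: ev i) - psi x by rewrite /psi; ring.
by rewrite e1 mulrC mulKf ?expf_neq0 // distrC.
Unshelve. all: by end_near. Qed.

(** The double increment is the same for [(i, j)] and [(j, i)], so both entries lie within [e / 2]
    of one number. *)
Lemma hessian_sym f x : C2_at f x -> (hessian f x)^T = hessian f x.
Proof.
move=> C2; apply/matrixP => i j; rewrite mxE.
apply/eqP; rewrite -subr_eq0 -normr_le0; apply/ler_addgt0Pr => e e0; rewrite add0r.
have e2 : 0 < e / 2 by rewrite divr_gt0.
have [h [h1 h2]] := @filter_ex _ (0 : R)^' _ _
  (filterI (hessian_double_increment i j C2 e2) (hessian_double_increment j i C2 e2)).
move: h1 h2; rewrite (addrAC x (h *: ev j)).
have -> a b c w : a - b - c + w = a - c - b + w :> R by ring.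
move: (hessian f x i j) (hessian f x j i) => p q.
by rewrite !ler_norml => /andP[? ?] /andP[? ?]; apply/andP; split; lra.
Qed.

(** Each line [x + s v] is treated by [second_derivative_max], with slope [L v] and second
    derivative [K v]; taking [v = ev i] gives the partial derivatives. *)
Lemma hessian_max f x : C2_at f x -> (\forall y \near x, f y <= f x) ->
  (forall i, 'D_(ev i) f x = 0) /\ psd (- hessian f x).
Proof.
move=> C2 mx.
pose P y := forall i j : 'I_n,
  [/\ derivable f y (ev i), {for y, continuous (fun z => 'D_(ev i) f z)} &
      derivable (fun z => 'D_(ev i) f z) y (ev j)].
have C2P : \forall y \near x, P y by apply: filterS C2 => y Cy i j; have [] := Cy i j.
have : \forall y \near x, (\forall z \near y, P z) /\ f y <= f x.
  by apply: filterI mx; exact: nbhs_interior C2P.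
move=> /nbhs_ballP[d /= d0 Hd].
pose L v y := \sum_i v 0 i * 'D_(ev i) f y.
pose K v := \sum_i v 0 i * \sum_j v 0 j * hessian f x i j.
have key v : L v x = 0 /\ K v <= 0.
  have v1 : 0 < `|v| + 1 by rewrite ltr_wpDl.
  have inb (s : R) : `|s| < d / (`|v| + 1) -> ball x d (x + s *: v).
    rewrite -ball_normE /= opprD addNKr normrN normrZ ltr_pdivlMr //.
    by apply: le_lt_trans; rewrite ler_wpM2l // lerDl.
  have := @second_derivative_max (fun s => f (x + s *: v)) (fun s => L v (x + s *: v))
    _ (K v) (divr_gt0 d0 v1).
  rewrite scale0r addr0; apply.
  - move=> s /inb /Hd[/= C2s _].
    have dn : \forall z \near x + s *: v, forall i, derivable f z (ev i).
      by apply: filterS C2s => z Cz i; have [] := Cz i i.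
    have [] := @is_derive_partials _ _ f (x + s *: v) v dn.
      by move=> i; have [] := nbhs_singleton C2s i i.
    by move=> d1 d2; rewrite -/(L v _) in d2; rewrite -d2; exact: is_derive_line.
  - by move=> s /inb /Hd[].
  - have dL : is_derive x v (L v) (K v).
      have -> : L v = \sum_i (v 0 i *: (fun y => 'D_(ev i) f y)).
        by apply/funext => y; rewrite fct_sumE.
      apply: is_derive_sum => i; apply: is_deriveZ.
      rewrite (eq_bigr (fun j => v 0 j * 'D_(ev j) (fun z => 'D_(ev i) f z) x)); last first.
        by move=> j _; rewrite mxE.
      have dn : \forall y \near x, forall j : 'I_n,
          derivable (fun z => 'D_(ev i) f z) y (ev j).
        by apply: filterS C2P => y Py j; have [] := Py i j.
      apply: (is_derive_partials v dn) => j.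
      by have [_ _ _] := nbhs_singleton C2 i j.
    have [d1 <-] := dL; rewrite -[x in 'D_v _ x]addr0 -(scale0r v).
    by apply: is_derive_line; rewrite scale0r addr0.
split=> [i|v].
  have [] := key (ev i); rewrite /L (bigD1 i) //= mxE !eqxx mul1r big1 ?addr0 // => j ji.
  by rewrite mxE (negbTE ji) andbF mul0r.
have [_] := key v; rewrite mulmxN dotNl oppr_ge0; congr (_ <= 0).
rewrite dot_mulmx_tr; apply: eq_bigr => i _; rewrite mxE; congr (_ * _).
by apply: eq_bigr => j _; rewrite [in RHS]mxE.
Qed.

End SecondOrder.

(** * Sign of the divergence of the flux at a spatial maximum *)

Section DivergenceAtMax.
Context {R : realType} (N : nat) (alpha a : nat -> R) (k : 'rV[R]_3) (Rs : R).
Hypothesis alpha0 : alpha 0%N = 0.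
Hypothesis alpha_lt : forall i : nat, (i < N)%N -> alpha i < alpha i.+1.
Hypothesis a_gt0 : forall i : nat, (i <= N)%N -> 0 < a i.
Hypothesis k1 : enorm k = 1.

Lemma trmx_Jmx2 : (Jmx k *m Jmx k)^T = Jmx k *m Jmx k.
Proof.
have JT : (Jmx k)^T = - Jmx k.
  apply/matrixP => i j.
  have := dot_Jmapl k (delta_mx 0 j) (delta_mx 0 i).
  by rewrite dot_delta dotC dot_delta !mxE.
by rewrite trmx_mul JT mulNmx mulmxN opprK.
Qed.

(** The derivative of the second argument of [X] at [x] is [M], and that of [V] is [M] times the
    inverse Jacobian; the divergence is the trace of this product. Here [c] is the part of the drift
    that is constant in space. *)
Lemma divergence_flux_max (f : 'rV[R]_3 -> R) (V : 'rV[R]_3 -> 'rV[R]_3)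
    (c x : 'rV[R]_3) (Om : R) :
  C2_at f x -> (\forall y \near x, f y <= f x) ->
  (forall y, V y = Xfun N a alpha k Rs (f y)
     (grad f y + f y ^+ 2 *: (c + Om ^+ 2 *: Jmap k (Jmap k y)))) ->
  \sum_(i < 3) 'D_(ev i) (fun y => V y 0 i) x <= 0.
Proof.
move=> C2 mx VE; have [grad0 psdH] := hessian_max C2 mx.
pose b := f x ^+ 2 * Om ^+ 2.
pose M := hessian f x + b *: (Jmx k *m Jmx k).
pose B := dFmx N alpha a k (Rs * f x) (V x).
have dV i : 'D_(ev i) (fun y => V y 0 i) x = (M *m invmx B) i i.
  have df := nbhs_singleton C2.
  (* [f] is stationary at [x], so the first argument of [X] has derivative [0], as [is_derive_Finv]
     assumes. *)
  have dfi : is_derive (0 : R) 1 (fun h => f (x + h *: ev i)) 0.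
    apply: is_derive_eq _ (grad0 i); have := @is_derive_line _ _ f x (ev i) 0.
    by rewrite scale0r addr0; apply; have [] := df i i.
  pose Y h := grad f (x + h *: ev i) + f (x + h *: ev i) ^+ 2 *:
    (c + Om ^+ 2 *: Jmap k (Jmap k (x + h *: ev i))).
  have FV h : Ffun N a alpha k (Rs * f (x + h *: ev i)) (V (x + h *: ev i)) = Y h.
    by rewrite VE; exact: Ffun_Xfun.
  have dz : is_derive (0 : R) 1 (fun h => Rs * f (x + h *: ev i)) 0.
    by apply: is_derive_eq (is_deriveZ Rs dfi) _; rewrite scaler0.
  have dY j : is_derive (0 : R) 1 (fun h => Y h 0 j) (row i M 0 j).
    have dH : is_derive (0 : R) 1 (fun h => 'D_(ev j) f (x + h *: ev i)) (hessian f x i j).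
      rewrite -(hessian_sym C2) !mxE.
      have := @is_derive_line _ _ (fun z => 'D_(ev j) f z) x (ev i) 0.
      by rewrite scale0r addr0; apply; have [] := df j i.
    pose w := Jmap k (Jmap k (ev i)).
    have wE : w 0 j = (Jmx k *m Jmx k) i j.
      by rewrite /w -!mul_Jmx -mulmxA -rowE mxE.
    (* The drift is affine in [h]; as [f] is stationary, only the slope of [Z] times [f x ^+ 2]
       survives. *)
    pose Z (h : R) := (c + Om ^+ 2 *: Jmap k (Jmap k x)) 0 j + h * (Om ^+ 2 * w 0 j).
    have -> : (fun h => Y h 0 j) = (fun h => 'D_(ev j) f (x + h *: ev i)) +
        (fun h => f (x + h *: ev i)) * (fun h => f (x + h *: ev i)) * Z.
      apply/funext => h; rewrite /Y !fctE !JmapD !JmapZ /Z -/w.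
      rewrite mxE [grad _ _ _ _]mxE; congr (_ + _).
      move: (f _) (Jmap k (Jmap k x)) => fh q; rewrite !mxE; ring.
    apply: is_derive_eq (is_deriveD dH (is_deriveM (is_deriveM dfi dfi)
      (is_derive_affine _ _ 0))) _.
    rewrite !fctE /= scale0r addr0 !scaler0 addr0 scaler0 addr0.
    rewrite [RHS]mxE [RHS]mxE [X in _ = _ + X]mxE -wE /b /GRing.scale /=; congr (_ + _).
    ring.
  have := is_derive_Finv alpha0 alpha_lt a_gt0 FV dz dY i.
  rewrite scale0r addr0 -/B => dVi.
  have [_ ->] := @is_derive_at_line _ _ (fun y => V y 0 i) x (ev i) _ dVi.
  by rewrite -row_mul mxE.
under eq_bigr do rewrite dV.
(* [J] is skew, so the form of [- J^2] at [y] is [|J y|^2]. *)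
have psdM : psd (- M).
  move=> y; rewrite /M opprD mulmxDr dotDl; apply: addr_ge0; first exact: psdH.
  rewrite mulmxN dotNl -scalemxAr dotZl mulmxA !mul_Jmx dot_Jmapl mulrN opprK.
  by rewrite mulr_ge0 ?dotxx_ge0 // mulr_ge0 ?sqr_ge0.
have symM : (- M)^T = - M.
  by rewrite linearN /= linearD /= linearZ /= (hessian_sym C2) trmx_Jmx2.
have psdB := psd_invmx_dFmx k alpha0 alpha_lt a_gt0 (Rs * f x) (V x).
have := mxtrace_mul_ge0 symM psdM psdB.
by rewrite mulNmx linearN /= oppr_ge0.
Qed.

End DivergenceAtMax.

(** * One-sided time derivatives and slices at fixed time *)

Section Parabolic.
Context {R : realType}.

(** Only times before [t] are compared, which covers [t = T]: dividing by a negative increment turns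
    maximality into a lower bound for the quotient. *)
Lemma has_deriv_within_ge (f : R -> R) (T t l e : R) : 0 < t <= T ->
  (forall s, 0 < s <= T -> f s - e * s <= f t - e * t) ->
  has_deriv_within f [set s | 0 < s <= T] t l -> e <= l.
Proof.
move=> /andP[t0 tT] mx lim; rewrite leNgt; apply/negP => le.
have : nbhs (0 : R) (fun h => h != 0 -> 0 < t + h <= T -> h^-1 * (f (t + h) - f t) < e).
  exact: (@cvgr_lt _ _ _ _ _ _ lim _ le).
move=> /nbhs_ballP[d /= d0 Hd].
pose h := Num.min (d / 2) (t / 2).
have h0 : 0 < h by rewrite lt_min !divr_gt0.
have hd : h < d by rewrite gt_min ltr_pdivrMr // ltr_pMr // ltr1n.
have ht : h < t by rewrite gt_min orbC ltr_pdivrMr // ltr_pMr // ltr1n.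
have th : 0 < t + - h <= T by apply/andP; split; lra.
have : (- h)^-1 * (f (t + - h) - f t) < e.
  apply: Hd => //; first by rewrite /ball /= sub0r opprK gtr0_norm.
  by rewrite oppr_eq0 gt_eqF.
rewrite invrN mulNr -mulrN mulrC ltr_pdivrMr // => lt_e.
have := mx _ th; lra.
Qed.

(** Openness of [U] removes the relative topology in space; [t] stays fixed and may be an endpoint
    of [I]. *)
Lemma continuous_slice {n : nat} (U : set 'rV[R]_n) (I : set R)
    (g : 'rV[R]_n * R -> R) (t : R) (x : 'rV[R]_n) : open U -> I t -> U x ->
  {within [set p | U p.1 /\ I p.2], continuous g} ->
  {for x, continuous (fun y => g (y, t))}.
Proof.
move=> oU It Ux /subspace_continuousP /(_ (x, t)) cg.
apply: cvg_trans (cg _); last by [].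
move=> P wP; have Un : nbhs x U by exact: open_nbhs_nbhs.
have : nbhs x (fun y => (U y /\ I t) -> P (g (y, t))).
  have ct : (fun y => (y, t)) @ x --> (x, t).
    exact: (@cvg_pair _ _ _ (nbhs x) (nbhs x) (nbhs t) (nbhs_filter x) (nbhs_filter x)
      (nbhs_filter t) id (fun=> t) cvg_id (cvg_cst t)).
  exact: (ct _ wP).
move=> h; apply: (@filterS _ (nbhs x) (nbhs_filter x) _ _ _ (filterI Un h)) => y [Uy].
by apply.
Qed.

End Parabolic.

(** * Compactness and penalisation in time *)

Unset Implicit Arguments.

Theorem theorem5p1 (R : realType)
  (N : nat) (alpha a : nat -> R) (k : 'rV[R]_3) (Rs G Om : R)
  (e0 : R -> 'rV[R]_3) (U : set 'rV[R]_3) (T : R)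
  (u ut : 'rV[R]_3 -> R -> R) :
  (1 <= N)%N ->
  alpha 0%N = 0 ->
  (forall i : nat, (i < N)%N -> alpha i < alpha i.+1) ->
  (forall i : nat, (i <= N)%N -> 0 < a i) ->
  enorm k = 1 ->
  0 <= Rs -> 0 < G -> 0 <= Om ->
  smooth_curve e0 -> (forall t, enorm (e0 t) = 1) ->
  open U -> bounded_set U -> C1_boundary U -> (exists x, U x) ->
  0 < T ->
  let UT := [set p : 'rV[R]_3 * R | U p.1 /\ 0 < p.2 <= T] in
  let cUT := [set p : 'rV[R]_3 * R | closure U p.1 /\ 0 <= p.2 <= T] in
  let pUT := cUT `\` UT in
  (* u in C(cl U_T) *)
  {within cUT, continuous (fun p => u p.1 p.2)} ->
  (* u in C^{2,1}_{x,t}(U_T) *)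
  (forall x t, UT (x, t) -> forall i j : 'I_3,
      derivable (fun y => u y t) x (ev i) /\
      derivable (fun y => derive (fun z => u z t) y (ev i)) x (ev j)) ->
  (forall i : 'I_3,
      {within UT, continuous (fun p => derive (fun z => u z p.2) p.1 (ev i))}) ->
  (forall i j : 'I_3,
      {within UT, continuous (fun p =>
         derive (fun y => derive (fun z => u z p.2) y (ev i)) p.1 (ev j))}) ->
  (forall x t, UT (x, t) ->
      has_deriv_within (fun s => u x s) [set s | 0 < s <= T] t (ut x t)) ->
  {within UT, continuous (fun p => ut p.1 p.2)} ->
  (* u >= 0 *)
  (forall p, cUT p -> 0 <= u p.1 p.2) ->
  (* u_t = div ( X(u, grad u + u^2 Z(x,t)) ) in U_T *)
  (forall x t, UT (x, t) ->
      let V := fun y : 'rV[R]_3 =>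
        Xfun N a alpha k Rs (u y t)
          (grad (fun z => u z t) y + (u y t ^+ 2) *: Zfun G Om e0 k y t) in
      (forall i : 'I_3, derivable (fun y => V y 0 i) x (ev i)) /\
      ut x t = \sum_(i < 3) derive (fun y => V y 0 i) x (ev i)) ->
  (* max over cl U_T = max over parabolic boundary *)
  exists q, pUT q /\ forall p, cUT p -> u p.1 p.2 <= u q.1 q.2.
Proof.
move=> _ alpha0 alpha_lt a_gt0 k1 _ _ _ _ _ oU bU _ [x0 Ux0] T0 UT cUT pUT.
move=> cu dux cdu cddu dut _ _ pde.
have cUTE : cUT = closure U `*` `[0, T].
  by apply/seteqP; split=> -[x t] /=; rewrite in_itv.
have cmpU : compact cUT.
  rewrite cUTE; apply: compact_setX; last exact: segment_compact.
  apply: bounded_closed_compact; last exact: closed_closure.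
  have [M [Mreal HM]] := bU; exists M; split=> // r Mr x clx.
  apply/ler_addgt0Pr => eps eps0.
  have [y [Uy]] := clx _ (nbhsx_ballx x eps eps0); rewrite -ball_normE /= => xy.
  rewrite -[x](subrK y) addrC; apply: le_trans (ler_normD _ _) _.
  by apply: lerD; [exact: HM | exact: ltW].
have cmp_pUT : compact pUT.
  (* On [cUT] the bound [t <= T] is automatic, so removing [UT] amounts to removing an open set. *)
  have -> : pUT = cUT `&` ~` [set p | U p.1 /\ 0 < p.2].
    apply/seteqP; split=> -[x t] [cxt nU]; split=> // -[Ux tp]; apply: nU.
      by split=> //; rewrite tp; case: cxt => _ /andP[].
    by split=> //; case/andP: tp.
  apply: compact_closedI => //; apply: open_closedC.
  have -> : [set p | U p.1 /\ 0 < p.2] =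
      fst @^-1` U `&` (snd : 'rV[R]_3 * R -> R) @^-1` [set t | 0 < t] by [].
  apply: openI; first by apply: open_comp => // r _; exact: cvg_fst.
  by apply: open_comp; [move=> r _; exact: cvg_snd | exact: open_gt].
have [q] : exists2 q, q \in pUT & forall p, p \in pUT -> u p.1 p.2 <= u q.1 q.2.
  apply: (compact_EVT_max _ cmp_pUT).
    exists (x0, 0); split=> /=; first by split; [exact: subset_closure|rewrite lexx ltW].
    by move=> [_ /andP[/=]]; rewrite ltxx.
  by apply: continuous_subspaceW cu => r [].
rewrite inE => pq maxq; exists q; split=> // p cp.
(* With this [d], the penalty [d t] lies between [0] and [eps] on [cUT]. *)
apply/ler_addgt0Pr => eps eps0; pose d := eps / T.
have d0 : 0 < d by exact: divr_gt0.
have [[x t]] : exists2 r, r \in cUT &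
    forall p, p \in cUT -> u p.1 p.2 - d * p.2 <= u r.1 r.2 - d * r.2.
  apply: (compact_EVT_max _ cmpU); first by exists p.
  move=> r; apply: cvgB; first exact: cu.
  have cd : continuous (fun p : 'rV[R]_3 * R => d * p.2).
    by move=> z; apply: cvgM; [exact: cvg_cst | exact: cvg_snd].
  exact: (continuous_subspaceT cd).
rewrite inE /= => cxt maxxt.
have leT (r : 'rV[R]_3 * R) : cUT r -> 0 <= d * r.2 <= eps.
  move=> [_ /andP[r0 rT]]; rewrite mulr_ge0 ?(ltW d0) //=.
  by rewrite /d mulrAC ler_pdivrMr // ler_pM2l.
have /andP[_ dp] := leT _ cp; have /andP[dt _] := leT _ cxt.
have := maxxt p; rewrite inE => /(_ cp) le_p.
(* If the penalised maximum lies on the parabolic boundary, then [u] at [p] is at most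
   [u x t + eps], hence at most its value at [q] plus [eps]. *)
have [UTxt|nUT] := pselect (UT (x, t)); last first.
  have := maxq (x, t); rewrite inE => /(_ (conj cxt nUT)) /=.
  by move: dt dp le_p => /=; lra.
(* Otherwise maximality in time gives [ut x t >= d > 0], while maximality in space gives
   [ut x t <= 0]. *)
exfalso; have [/= Ux tT] := UTxt.
have maxU y : U y -> u y t <= u x t.
  move=> Uy; have := maxxt (y, t); rewrite inE /= lerD2r; apply.
  by split=> /=; [exact: subset_closure | case: cxt].
have le_ut : d <= ut x t.
  apply: (has_deriv_within_ge tT _ (dut x t UTxt)) => s /andP[s0 sT].
  have := maxxt (x, s); rewrite inE /=; apply.
  by split=> /=; [exact: subset_closure | rewrite ltW].
have nearU : \forall y \near x, U y by exact: open_nbhs_nbhs.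
have C2 : C2_at (fun y => u y t) x.
  apply: filterS nearU => y Uy i j; have UTy : UT (y, t) by [].
  have [d1 d2] := dux y t UTy i j.
  split; [exact: d1 | | exact: d2 |].
    exact: (@continuous_slice _ _ U [set s | 0 < s <= T] _ t y oU tT Uy (cdu i)).
  exact: (@continuous_slice _ _ U [set s | 0 < s <= T] _ t x oU tT Ux (cddu i j)).
have [_ utE] := pde x t UTxt.
suff : ut x t <= 0 by rewrite leNgt (lt_le_trans d0 le_ut).
rewrite utE; apply: (divergence_flux_max alpha0 alpha_lt a_gt0 k1
  (f := fun y => u y t) (c := - (G *: e0 t)) (Om := Om) C2) => //.
by apply: filterS nearU => y; exact: maxU.
Qed.
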